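(* Assume that $r_k=k^{-\tau_W}L(k)$, $k\ge1$, for some $\tau_W>2$ and some slowly varying function $k\mapsto L(k)$. Then $p_k=k^{-\tau}\hat L(k)$ for some slowly varying function $k\mapsto\hat L(k)$, with power-law exponent $$\tau=\min\{\tau_W,\tau_P\},\qquad \tau_P=3+\delta/\mu .$$ When $r_k$ decays faster than a power law, the same holds with the convention that $\tau_W=\infty$, i.e. $p_k=k^{-\tau_P}\hat L(k)$ for some slowly varying function $k\mapsto\hat L(k)$.
   Context: Let $W_1$ be a positive-integer-valued random variable with support $S_W$, $r_k=\mathbb{P}(W_1=k)$ for $k\ge1$, and $\mu=\mathbb{E}[W_1]$ (finite under the hypotheses). Let $\delta\in\mathbb{R}$ be fixed with $\delta+\min\{x:x\in S_W\}>0$, and let $\theta=2+\delta/\mu$. Define $$p_k=\frac{\theta}{k+\delta+\theta}\sum_{i=0}^{k-1}r_{k-i}\prod_{j=1}^{i}\frac{k-j+\delta}{k-j+\delta+\theta},\qquad k\ge1,$$ where the empty product ($i=0$) equals one, and the summands with $r_{k-i}=0$ are read as $0$ (so $p_k=0$ for $k<\min S_W$). A function $k\mapsto L(k)$ on the positive integers is slowly varying if it is eventually positive and $L(\lfloor ck\rfloor)/L(k)\to1$ as $k\to\infty$ for every $c>0$. ''$r_k$ decays faster than a power law'' means $k^ar_k\to0$ as $k\to\infty$ for every $a>0$. *)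

(* Defs.v *)
From HB Require Import structures.
From mathcomp Require Import all_boot all_order all_algebra.
From mathcomp Require Import all_classical all_reals all_analysis.
Set Implicit Arguments.
Unset Strict Implicit.
Unset Printing Implicit Defensive.
Import Order.TTheory GRing.Theory Num.Theory.
Import numFieldNormedType.Exports.
Local Open Scope classical_set_scope.
Local Open Scope ring_scope.

Definition natpmf d (T : measurableType d) (R : realType) (P : probability T R)
    (W : {RV P >-> nat}) (k : nat) : R :=
  fine (P (W @^-1` [set k])).

Definition natsupport d (T : measurableType d) (R : realType)
    (P : probability T R) (W : {RV P >-> nat}) : set nat :=
  [set k | 0 < natpmf W k].

(* Real-valued: [fine] sends an infinite expectation to 0. *)
Definition natmean d (T : measurableType d) (R : realType)
    (P : probability T R) (W : {RV P >-> nat}) : R :=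
  fine 'E_P[fun w => (W w)%:R].

(* Junk value 0 on the empty set. *)
Definition setmin (S : set nat) : nat := xget 0%N (S `&` lbound S).

Lemma setminP (S : set nat) : S !=set0 -> S (setmin S) /\ lbound S (setmin S).
Proof.
move=> [k Sk].
have ex : exists n, `[< S n >] by exists k; apply/asboolP.
have [m /asboolP Sm mmin] := ex_minnP ex.
have Lm : (S `&` lbound S) m.
  by split=> // j Sj; rewrite leEnat; apply: mmin; apply/asboolP.
exact: (xgetPex 0%N (ex_intro _ m Lm)).
Qed.

(* A sequence on the positive integers is encoded as a function on [nat]; its
   value at 0 is irrelevant, as 1 <= c * k for all large k. [Num.truncn] is the
   floor on nonnegative reals. *)
Definition slowly_varying (R : realType) (L : nat -> R) : Prop :=
  (\forall k \near \oo, 0 < L k) /\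
  forall c : R, 0 < c ->
    (fun k : nat => L (Num.truncn (c * k%:R)) / L k) @ \oo --> (1 : R).

Definition faster_than_power_law (R : realType) (r : nat -> R) : Prop :=
  forall a : R, 0 < a -> (fun k : nat => k%:R `^ a * r k) @ \oo --> (0 : R).

(* If delta + m > 0 with m the least index where r is nonzero and theta > 0,
   the denominators are positive in every term with r (k - i) nonzero; the other
   terms, and the whole sum for k < m, vanish since inversion is total. *)
Definition degree_pmf (R : realType) (r : nat -> R) (delta theta : R)
    (k : nat) : R :=
  theta / (k%:R + delta + theta) *
  \sum_(0 <= i < k)
    r (k - i)%N *
    \prod_(1 <= j < i.+1)
      ((k%:R - j%:R + delta) / (k%:R - j%:R + delta + theta)).

(* Main.v *)
Require Import Defs.
From HB Require Import structures.
From mathcomp Require Import all_boot all_order all_algebra.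
From mathcomp Require Import all_classical all_reals all_analysis.
From mathcomp Require Import ring lra.
Set Implicit Arguments.
Unset Strict Implicit.
Unset Printing Implicit Defensive.
Import Order.TTheory GRing.Theory Num.Theory.
Import numFieldNormedType.Exports.
Local Open Scope classical_set_scope.
Local Open Scope ring_scope.

(** Put A_n = \prod_(m <= l < n) (l + delta) / (l + delta + theta), where m is
    the least index with r_m > 0. The inner product in p_k runs over the factors
    of A_k that are not factors of A_(k-i), so it equals A_k / A_(k-i) and
      p_k = theta / (k + delta + theta) * A_k * S_k,
      S_k = \sum_(n <= k) r_n / A_n
    ([degree_pmfE]). The first factor is regularly varying of index -1. Since
    theta > 0, k^theta A_k converges to a positive constant
    ([survival_asymptotic]), so A_k has index -theta. Hence everything depends
    on S_k, whose summands are of order n^theta r_n.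

    If r_n decays faster than any power, S_k converges to a positive limit, so
    p_k has index -(1 + theta) = -tauP. If r_n has index -tauW, the summands have
    index rho - 1 with rho = theta - tauW + 1, and their partial sums have index
    max(rho, 0) ([regularly_varying_series], a form of Karamata's theorem). Adding
    the indices gives -(1 + theta) + max(rho, 0) = -min(tauW, tauP).

    Karamata's theorem is usually derived from the uniform convergence theorem or
    a representation theorem for slowly varying functions. Neither is used here,
    thanks to two remarks. The defining limit with c = 1/q, read along the
    indices q n + j, compares a_(q n + j) with a_n exactly, since
    floor((q n + j) / q) = n; grouping the terms in blocks of length q therefore
    compares S_(q k) with S_k. With q = 2 this decides convergence by a doubling
    argument, and when S diverges the Stolz-Cesaro theorem gives S_(q k) / S_k ->
    q^rho for every integer q. As S is monotone, integer multipliers determine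
    all real ones ([monotone_regularly_varying]). *)

(** * Regular variation of sequences *)

Lemma cvg_powR (R : realType) (T : Type) (F : set_system T) {FF : Filter F}
    (u : T -> R) (c rho : R) :
  0 < c -> u @ F --> c -> (fun t => u t `^ rho) @ F --> c `^ rho.
Proof.
move=> c0 uc.
suff cont : {for c, continuous (fun x : R => x `^ rho)} by exact: cvg_comp uc cont.
apply/differentiable_continuous/derivable1_diffP/derivable_powR.
by rewrite in_itv /= andbT.
Qed.

Lemma powR_div (R : realType) (x y rho : R) : 0 <= x -> 0 <= y ->
  (x / y) `^ rho = x `^ rho / y `^ rho.
Proof.
move=> x0 y0; rewrite powRM ?invr_ge0//; congr (_ * _).
by rewrite -[in LHS]powR_inv1// -powRrM mulN1r powRN.
Qed.

Section RegularVariation.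
Context {R : realType}.
Implicit Types (f g : nat -> R) (rho sigma c : R).

(** Slow variation is the case [rho = 0]; keeping the power inside the notion
    lets indices be added instead of factoring powers out at each step. *)
Definition regularly_varying rho f : Prop :=
  (\forall k \near \oo, 0 < f k) /\
  forall c : R, 0 < c ->
    (fun k : nat => f (Num.truncn (c * k%:R)) / f k) @ \oo --> c `^ rho.

Lemma regularly_varying0 f : regularly_varying 0 f <-> slowly_varying f.
Proof.
by split=> -[f0 fc]; split=> // c c0; move: (fc c c0); rewrite powRr0.
Qed.

Lemma cvg_truncn_ratio c : 0 < c ->
  ((Num.truncn (c * k%:R))%:R / k%:R : R) @[k --> \oo] --> c.
Proof.
move=> c0; apply/cvgrPdist_le => e e0.
near=> k.
have k0 : 0 < k%:R :> R by rewrite ltr0n; near: k; exact: nbhs_infty_gt.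
have /andP[lo hi] := truncn_itv (mulr_ge0 (ltW c0) (ltW k0)).
have ek : e^-1 <= k%:R by near: k; exact: nbhs_infty_ger.
rewrite -{1}[c](mulfK (lt0r_neq0 k0)) -mulrBl normrM normfV (gtr0_norm k0).
rewrite ger0_norm ?subr_ge0// ler_pdivrMr//.
rewrite (@le_trans _ _ 1)//; first by rewrite lerBlDl natr1 ltW.
by rewrite -ler_pdivrMl// mulr1.
Unshelve. all: by end_near. Qed.

Lemma cvg_ratio_infty (h : nat -> nat) c : 0 < c ->
  ((h k)%:R / k%:R : R) @[k --> \oo] --> c -> h @ \oo --> \oo.
Proof.
move=> c0 hc; apply/cvgnyPge => A; near=> k.
have k0 : 0 < k%:R :> R by rewrite ltr0n; near: k; exact: nbhs_infty_gt.
rewrite -(ler_nat R).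
have : c / 2 <= (h k)%:R / k%:R.
  by near: k; apply: (cvgr_ge c) => //; lra.
rewrite ler_pdivlMr//; apply: le_trans.
rewrite -ler_pdivrMl ?divr_gt0//; near: k; exact: nbhs_infty_ger.
Unshelve. all: by end_near. Qed.

Lemma cvg_truncn_infty c : 0 < c ->
  (fun k => Num.truncn (c * k%:R : R)) @ \oo --> \oo.
Proof. by move=> c0; apply: (cvg_ratio_infty c0); exact: cvg_truncn_ratio. Qed.

Lemma eq_regularly_varying rho f g :
  (\forall k \near \oo, f k = g k) ->
  regularly_varying rho f -> regularly_varying rho g.
Proof.
move=> fg [f0 fc]; split=> [|c c0].
  by apply: filterS2 fg f0 => k ->.
apply: cvg_trans (fc c c0); apply: near_eq_cvg.
have fg' := cvg_truncn_infty c0 fg.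
by apply: filterS2 fg fg' => k /= -> ->.
Qed.

Lemma regularly_varyingM rho sigma f g :
  regularly_varying rho f -> regularly_varying sigma g ->
  regularly_varying (rho + sigma) (fun k => f k * g k).
Proof.
move=> [f0 fc] [g0 gc]; split=> [|c c0].
  by apply: filterS2 f0 g0 => k; exact: mulr_gt0.
rewrite powRD ?(gt_eqF c0) ?implybT//.
under eq_fun do rewrite invfM mulrACA.
exact: cvgM (fc c c0) (gc c c0).
Qed.

Lemma regularly_varyingV rho f :
  regularly_varying rho f -> regularly_varying (- rho) (fun k => (f k)^-1).
Proof.
move=> [f0 fc]; split=> [|c c0].
  by apply: filterS f0 => k; rewrite invr_gt0.
rewrite powRN; under eq_fun do rewrite -invfM.
by apply: cvgV; [rewrite lt0r_neq0// powR_gt0|exact: fc].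
Qed.

Lemma cvg_regularly_varying0 f (l : R) :
  0 < l -> f @ \oo --> l -> regularly_varying 0 f.
Proof.
move=> l0 fl; split=> [|c c0]; first exact: (cvgr_gt l fl).
have l_neq0 := lt0r_neq0 l0; rewrite powRr0.
suff : (fun k => f (Num.truncn (c * k%:R)) / f k) @ \oo --> l / l by rewrite divff.
apply: cvgM; last exact: cvgV.
exact: (cvg_comp _ _ (cvg_truncn_infty c0) fl).
Qed.

Lemma cvg_shift_ratio (s : R) : ((k%:R + s) / k%:R : R) @[k --> \oo] --> (1 : R).
Proof.
apply/cvgrPdist_le => e e0; near=> k.
have k0 : 0 < k%:R :> R by rewrite ltr0n; near: k; exact: nbhs_infty_gt.
rewrite mulrDl divff ?lt0r_neq0// opprD addrA subrr sub0r normrN normrM normfV.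
rewrite (gtr0_norm k0) ler_pdivrMr// -ler_pdivrMl//.
near: k; exact: nbhs_infty_ger.
Unshelve. all: by end_near. Qed.

(** Allows a negative shift [s], where [k%:R + s] is positive only eventually. *)
Lemma powR_shift_regularly_varying rho (s : R) :
  regularly_varying rho (fun k => (k%:R + s) `^ rho).
Proof.
have pos : \forall k \near \oo, 0 < k%:R + s.
  near=> k; rewrite -ltrBlDr sub0r; near: k; exact: nbhs_infty_gtr.
split=> [|c c0]; first by apply: filterS pos => k /powR_gt0; exact.
have cs : (((Num.truncn (c * k%:R))%:R + s) / (k%:R + s) : R) @[k --> \oo] --> c.
  have shift_t : ((fun k => (k%:R + s) / k%:R) \o (fun k => Num.truncn (c * k%:R)))
      @ \oo --> (1 : R).
    exact: (cvg_comp _ _ (cvg_truncn_infty c0) (cvg_shift_ratio s)).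
  have : (fun k => (((Num.truncn (c * k%:R))%:R + s) / (Num.truncn (c * k%:R))%:R)
      * ((Num.truncn (c * k%:R))%:R / k%:R) / ((k%:R + s) / k%:R)) @ \oo
      --> 1 * c / 1.
    apply: cvgM; last by apply: cvgV; [exact: oner_neq0|exact: cvg_shift_ratio].
    by apply: cvgM; [exact: shift_t|exact: cvg_truncn_ratio].
  rewrite divr1 mul1r => lim_prod.
  apply: cvg_trans lim_prod; apply: near_eq_cvg; near=> k.
  have k0 : k%:R != 0 :> R.
    by rewrite lt0r_neq0// ltr0n; near: k; exact: nbhs_infty_gt.
  have t0 : (Num.truncn (c * k%:R : R))%:R != 0 :> R.
    rewrite lt0r_neq0// ltr0n; near: k.
    exact: (cvg_truncn_infty c0 (nbhs_infty_gt 0)).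
  have ks : k%:R + s != 0 by rewrite lt0r_neq0//; near: k.
  by field; rewrite k0 t0 ks.
have lim_pow : (fun k => (((Num.truncn (c * k%:R))%:R + s) / (k%:R + s)) `^ rho)
    @ \oo --> c `^ rho by exact: cvg_powR.
apply: cvg_trans lim_pow; apply: near_eq_cvg.
have pos' := cvg_truncn_infty c0 pos.
apply: filterS2 pos pos' => k /= k0 t0.
by rewrite powR_div ?(ltW k0) ?(ltW t0).
Unshelve. all: by end_near. Qed.

Lemma powR_regularly_varying rho : regularly_varying rho (fun k => k%:R `^ rho).
Proof.
apply: eq_regularly_varying (powR_shift_regularly_varying rho 0).
by apply: nearW => k; rewrite addr0.
Qed.

(** The defining limit along a subsequence on which the floor is known exactly;
    with [c = 1 / q] and [u n = q * n + j] the floor is [n]. *)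
Lemma regularly_varying_subseq_ratio rho f c (h u : nat -> nat) :
  0 < c -> regularly_varying rho f -> u @ \oo --> \oo ->
  (forall n, Num.truncn (c * (u n)%:R) = h n) ->
  (f (h n) / f (u n)) @[n --> \oo] --> c `^ rho.
Proof.
move=> c0 [_ fc] uoo hu; under eq_fun do rewrite -hu.
exact: (cvg_comp _ _ uoo (fc c c0)).
Qed.

End RegularVariation.

(** * Monotone sequences: from integer to real multipliers *)

Section MonotoneRegularVariation.
Context {R : realType}.
Implicit Types (c rho : R).

Lemma fraction_between (x y : R) : 0 <= x -> x < y ->
  exists p q : nat, [/\ (0 < p)%N, (0 < q)%N & x < p%:R / q%:R < y].
Proof.
move=> x0 xy.
(* A denominator above 1 / (y - x) makes the multiples of 1 / q finer than the
   gap; the numerator is then the first multiple beyond x. *)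
pose q := (Num.truncn (y - x)^-1).+1.
have d0 : 0 < y - x by rewrite subr_gt0.
have q0 : 0 < q%:R :> R by rewrite ltr0n.
have dq : 1 < (y - x) * q%:R by rewrite -ltr_pdivrMl// mulr1 truncnS_gt.
exists (Num.truncn (x * q%:R)).+1, q; split => //.
rewrite ltr_pdivlMr// truncnS_gt/= ltr_pdivrMr// -natr1.
have /andP[lo _] := truncn_itv (mulr_ge0 x0 (ltW q0)).
by move: dq; rewrite mulrBl; lra.
Qed.

Lemma powR_fraction_approx c rho (e : R) : 0 < c -> 0 < e ->
  (exists p q : nat, [/\ (0 < p)%N, (0 < q)%N, c < p%:R / q%:R &
     (p%:R / q%:R) `^ rho <= c `^ rho + e]) /\
  (exists p q : nat, [/\ (0 < p)%N, (0 < q)%N, p%:R / q%:R < c &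
     c `^ rho - e <= (p%:R / q%:R) `^ rho]).
Proof.
move=> c0 e0.
have lim : (fun x : R => x `^ rho) @ c --> c `^ rho by apply: cvg_powR => //.
have /cvgrPdist_le/(_ _ e0)/nbhs_ballP[d /= d0 dP] := lim.
split.
  have [p [q [p0 q0 /andP[lo hi]]]] : exists p q : nat,
      [/\ (0 < p)%N, (0 < q)%N & c < p%:R / q%:R < c + d].
    by apply: fraction_between; lra.
  exists p, q; split => //.
  have := dP (p%:R / q%:R); rewrite /ball/= ltr0_norm; last lra.
  by move=> /(_ ltac:(lra)); rewrite ler_norml; lra.
have [p [q [p0 q0 /andP[lo hi]]]] : exists p q : nat,
    [/\ (0 < p)%N, (0 < q)%N & Num.max 0 (c - d) < p%:R / q%:R < c].
  by apply: fraction_between; rewrite ?le_max ?lexx// gt_max c0/=; lra.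
exists p, q; split => //.
move: lo; rewrite gt_max => /andP[_ lo].
have := dP (p%:R / q%:R); rewrite /ball/= gtr0_norm; last lra.
by move=> /(_ ltac:(lra)); rewrite ler_norml; lra.
Qed.

(** If [c < p / q] then eventually [q * h k <= p * k], so monotonicity gives
    [S (h k) / S k <= S (h k) / S (q * h k) * (S (p * k) / S k)], and the right
    side tends to [q ^ - rho * p ^ rho]. Fractions below [c] bound the ratio from
    the other side, and [(p / q) ^ rho] is as close to [c ^ rho] as desired. A
    general [h], rather than the floor of [c * k], also covers index shifts. *)
Lemma monotone_regularly_varying rho c (S : nat -> R) (h : nat -> nat) :
  {homo S : n m / (n <= m)%N >-> n <= m} ->
  (\forall k \near \oo, 0 < S k) ->
  (forall q, (0 < q)%N -> (S (q * k)%N / S k) @[k --> \oo] --> q%:R `^ rho) ->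
  0 < c -> ((h k)%:R / k%:R : R) @[k --> \oo] --> c ->
  (S (h k) / S k) @[k --> \oo] --> c `^ rho.
Proof.
move=> Smono S0 Smul c0 hc.
have hoo := cvg_ratio_infty c0 hc.
have Sh0 : \forall k \near \oo, 0 < S (h k) by exact: hoo S0.
have lim_pq p q : (0 < p)%N -> (0 < q)%N ->
    (S (h k) / S (q * h k)%N * (S (p * k)%N / S k)) @[k --> \oo]
      --> (p%:R / q%:R) `^ rho.
  move=> p0 q0.
  have -> : (p%:R / q%:R) `^ rho = (q%:R `^ rho)^-1 * p%:R `^ rho :> R.
    by rewrite powR_div ?ler0n// mulrC.
  apply: cvgM; last exact: Smul.
  under eq_fun do rewrite -invf_div.
  apply: cvgV; first by rewrite lt0r_neq0// powR_gt0// ltr0n.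
  exact: (cvg_comp _ _ hoo (Smul q q0)).
apply/cvgrPdist_le => e e0.
have e20 : 0 < e / 2 by lra.
have [[p [q [p0 q0 cpq up]]] [p' [q' [p'0 q'0 cpq' lo]]]] :=
  powR_fraction_approx rho c0 e20.
near=> k.
have k0 : 0 < k%:R :> R by rewrite ltr0n; near: k; exact: nbhs_infty_gt.
have Sk0 : 0 < S k by near: k.
have Shk0 : 0 < S (h k) by near: k.
have q0R : 0 < q%:R :> R by rewrite ltr0n.
have q'0R : 0 < q'%:R :> R by rewrite ltr0n.
have Smul_gt0 n (j : nat) : (0 < j)%N -> 0 < S n -> 0 < S (j * n)%N.
  by move=> j0 /lt_le_trans; apply; apply: Smono; rewrite leq_pmull.
rewrite ler_norml; apply/andP; split.
  have hk : (q * h k <= p * k)%N.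
    rewrite -(ler_nat R) !natrM.
    have : (h k)%:R / k%:R <= p%:R / q%:R :> R.
      by near: k; apply: (cvgr_le c) => //.
    by rewrite ler_pdivrMr// mulrAC ler_pdivlMr// [_ * q%:R]mulrC.
  have : S (h k) / S (q * h k)%N * (S (p * k)%N / S k) <=
      (p%:R / q%:R) `^ rho + e / 2.
    near: k; apply: cvgr_le (lim_pq _ _ p0 q0) _ _; lra.
  suff : S (h k) / S k <= S (h k) / S (q * h k)%N * (S (p * k)%N / S k) by lra.
  have Sq0 := Smul_gt0 _ _ q0 Shk0.
  have -> : S (h k) / S (q * h k)%N * (S (p * k)%N / S k) =
      S (h k) / S k * (S (p * k)%N / S (q * h k)%N) by field; rewrite !lt0r_neq0.
  apply: ler_peMr; first by rewrite divr_ge0 ?ltW.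
  by rewrite ler_pdivlMr// mul1r; apply: Smono.
have hk : (p' * k <= q' * h k)%N.
  rewrite -(ler_nat R) !natrM.
  have : p'%:R / q'%:R <= (h k)%:R / k%:R :> R.
    by near: k; apply: (cvgr_ge c) => //.
  by rewrite ler_pdivrMr// mulrAC ler_pdivlMr// [_ * q'%:R]mulrC.
have : (p'%:R / q'%:R) `^ rho - e / 2 <=
    S (h k) / S (q' * h k)%N * (S (p' * k)%N / S k).
  near: k; apply: cvgr_ge (lim_pq _ _ p'0 q'0) _ _; lra.
suff : S (h k) / S (q' * h k)%N * (S (p' * k)%N / S k) <= S (h k) / S k by lra.
have Sq0 := Smul_gt0 _ _ q'0 Shk0.
have -> : S (h k) / S (q' * h k)%N * (S (p' * k)%N / S k) =
    S (h k) / S k * (S (p' * k)%N / S (q' * h k)%N) by field; rewrite !lt0r_neq0.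
apply: ler_piMr; first by rewrite divr_ge0 ?ltW.
by rewrite ler_pdivrMr// mul1r; apply: Smono.
Unshelve. all: by end_near. Qed.

End MonotoneRegularVariation.

(** * Partial sums of regularly varying sequences *)

Section PartialSums.
Context {R : realType}.
Implicit Types (a b : nat -> R) (rho : R).

Lemma nondecreasing_series_ge0 a : (forall n, 0 <= a n) ->
  {homo series a : n m / (n <= m)%N >-> n <= m}.
Proof.
by move=> a0 n m nm; rewrite -subr_ge0 sub_series_geq// sumr_ge0.
Qed.

(** Stolz-Cesaro: the terms of index below some [N] contribute a constant to the
    difference of [series b] and [l] times [series a], which is negligible as
    [series a] diverges. *)
Lemma stolz_series a b (l : R) :
  (\forall n \near \oo, 0 < a n) -> series a @ \oo --> +oo ->
  (b n / a n) @[n --> \oo] --> l ->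
  (series b k / series a k) @[k --> \oo] --> l.
Proof.
move=> a0 aoo abl; apply/cvgrPdist_le => e e0.
have e20 : 0 < e / 2 by lra.
have [N _ NP] : \forall n \near \oo, `|b n - l * a n| <= e / 2 * a n.
  move: abl => /cvgrPdist_le/(_ _ e20) abl; apply: filterS2 a0 abl => n an0 close.
  have -> : b n - l * a n = (b n / a n - l) * a n by field; rewrite lt0r_neq0.
  by rewrite normrM (gtr0_norm an0) distrC; apply: ler_wpM2r => //; exact: ltW.
pose C := `|series b N - l * series a N| - e / 2 * series a N.
have bound k : (N <= k)%N ->
    `|series b k - l * series a k| <= C + e / 2 * series a k.
  move=> Nk.
  have -> : series b k - l * series a k = (series b N - l * series a N) +
      \sum_(N <= n < k) (b n - l * a n).
    rewrite sumrB -mulr_sumr -!sub_series_geq//; ring.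
  rewrite (le_trans (ler_normD _ _))// /C -addrA lerD2l addrC -mulrBr.
  rewrite sub_series_geq// mulr_sumr (le_trans (ler_norm_sum _ _ _))//.
  rewrite [leLHS]big_nat [leRHS]big_nat ler_sum// => n /andP[Nn _]; exact: NP.
near=> k.
have A0 : 0 < series a k by near: k; apply: (cvgry_gt aoo).
have AC : C / (e / 2) <= series a k by near: k; apply: (cvgry_ge aoo).
rewrite distrC.
have -> : series b k / series a k - l = (series b k - l * series a k) / series a k.
  by field; rewrite lt0r_neq0.
rewrite normf_div (gtr0_norm A0) ler_pdivrMr//.
rewrite (le_trans (bound _ _))//; first by near: k; exact: nbhs_infty_ge.
by move: AC; rewrite ler_pdivrMr//; lra.
Unshelve. all: by end_near. Qed.

Lemma series_block a (q k : nat) :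
  series a (q * k)%N = series (fun n => \sum_(j < q) a (q * n + j)%N) k.
Proof.
rewrite !seriesEnat/= mulnC big_nat_mul; apply: eq_bigr => i _.
rewrite mulSn -{1}[(i * q)%N]add0n big_addn addnK big_mkord.
by apply: eq_bigr => j _; rewrite addnC mulnC.
Qed.

(** Each of the [q] terms of a block is asymptotic to [q ^ (rho - 1)] times
    [a n], because [floor ((q * n + j) / q) = n]. *)
Lemma block_ratio a rho (q : nat) : regularly_varying (rho - 1) a -> (0 < q)%N ->
  ((\sum_(j < q) a (q * n + j)%N) / a n) @[n --> \oo] --> q%:R `^ rho.
Proof.
move=> arv q0.
have q0R : 0 < q%:R :> R by rewrite ltr0n.
have qV0 : 0 < q%:R^-1 :> R by rewrite invr_gt0.
have one (j : 'I_q) : (a (q * n + j)%N / a n) @[n --> \oo] --> q%:R `^ (rho - 1).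
  have -> : q%:R `^ (rho - 1) = (q%:R^-1 `^ (rho - 1))^-1 :> R.
    by rewrite -[q%:R^-1]mul1r powR_div ?ler0n// powR1 div1r invrK.
  under eq_fun do rewrite -invf_div.
  apply: cvgV; first by rewrite lt0r_neq0// powR_gt0.
  apply: (regularly_varying_subseq_ratio (u := fun n => (q * n + j)%N) qV0 arv).
    apply/cvgnyPge => A; exists A => // n /= An.
    by rewrite (leq_trans An)// (leq_trans _ (leq_addr _ _))// leq_pmull.
  move=> n; apply: truncn_def.
  rewrite ler_pdivlMl// ltr_pdivrMl// -!natrM ler_nat ltr_nat.
  by rewrite leq_addr mulnS addnC ltn_add2r/=.
under eq_fun do rewrite mulr_suml.
have -> : q%:R `^ rho = \sum_(j < q) q%:R `^ (rho - 1) :> R.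
  have -> : q%:R `^ rho = q%:R `^ (rho - 1) * q%:R.
    have {1}-> : rho = rho - 1 + 1 by ring.
    by rewrite powRD ?(gt_eqF q0R) ?implybT// powRr1 ?ler0n.
  by rewrite sumr_const card_ord mulr_natr.
by apply: cvg_big => [|j _]; [exact: add_continuous|exact: one].
Qed.

Lemma cvg_ratioS (h : nat -> nat) (c : R) :
  ((h k)%:R / k%:R : R) @[k --> \oo] --> c ->
  ((h k).+1%:R / k%:R : R) @[k --> \oo] --> c.
Proof.
move=> hc.
have lim : (fun k => (h k)%:R / k%:R + ((k%:R + 1) / k%:R - 1)) @ \oo
    --> c + (1 - 1).
  by apply: cvgD => //; apply: cvgB; [exact: cvg_shift_ratio|exact: cvg_cst].
rewrite subrr addr0 in lim; apply: cvg_trans lim; apply: near_eq_cvg; near=> k.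
have k0 : 0 < k%:R :> R by rewrite ltr0n; near: k; exact: nbhs_infty_gt.
by rewrite -natr1; field; rewrite lt0r_neq0.
Unshelve. all: by end_near. Qed.

Lemma series_gt0 a : (forall n, 0 <= a n) -> (\forall n \near \oo, 0 < a n) ->
  \forall n \near \oo, 0 < series a n.
Proof.
move=> a_ge0 [N _ a_gt0]; exists N.+1 => // n /= Nn.
rewrite (lt_le_trans _ (nondecreasing_series_ge0 a_ge0 Nn))// seriesSr.
by rewrite ltr_wpDl ?sumr_ge0// a_gt0 /=.
Qed.

(** As [2 ^ rho < 1], the blocks of length 2 eventually satisfy
    [a (2 n) + a (2 n + 1) <= lam * a n] with [lam < 1]. Summing,
    [S k <= S (2 k) <= C + lam * S k], which bounds [S k] by [C / (1 - lam)]. *)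
Lemma cvg_series_regularly_varying_lt0 a rho :
  (forall n, 0 <= a n) -> regularly_varying (rho - 1) a -> rho < 0 ->
  cvgn (series a).
Proof.
move=> a_ge0 arv rho0; have Smono := nondecreasing_series_ge0 a_ge0.
have pow_lt1 : 2 `^ rho < 1 :> R.
  by rewrite /powR pnatr_eq0/= expR_lt1 nmulr_rlt0// ln_gt0 ?ltr1n.
(* Any number strictly between 1 and the limit 2 ^ rho of the block ratios. *)
pose lam : R := (1 + 2 `^ rho) / 2.
have [N _ block_le] : \forall n \near \oo,
    \sum_(j < 2) a (2 * n + j)%N <= lam * a n.
  have a_gt0 := arv.1; near=> n.
  rewrite -ler_pdivrMr; last by near: n.
  near: n; apply: (cvgr_le (2 `^ rho)); first exact: (block_ratio arv).
  by rewrite /lam; lra.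
pose b := fun n => \sum_(j < 2) a (2 * n + j)%N.
apply: nondecreasing_is_cvgn => //.
exists (series b N / (1 - lam)) => _ [k _ <-].
rewrite (le_trans (Smono _ _ (leq_addl N k)))// ler_pdivlMr; last by rewrite /lam; lra.
have doubling : series a (N + k)%N <= series b (N + k)%N.
  by rewrite -series_block; apply: Smono; rewrite leq_pmull.
have : series b (N + k)%N - series b N <= lam * (series a (N + k)%N - series a N).
  rewrite !sub_series_geq ?leq_addr// mulr_sumr.
  rewrite [leLHS]big_nat [leRHS]big_nat ler_sum// => n /andP[Nn _].
  exact: block_le.
have SN0 : 0 <= lam * series a N.
  by rewrite mulr_ge0 ?sumr_ge0// /lam; have := powR_ge0 2 rho; lra.
by move: doubling SN0; rewrite mulrBr mulrBr; lra.
Unshelve. all: by end_near. Qed.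

(** As [2 ^ rho > 1], the blocks eventually satisfy
    [a (2 n) + a (2 n + 1) >= lam * a n] with [lam > 1]. If the series converged,
    its tail from [2 N] would be at least [lam] times its tail from [N], hence
    strictly larger, although it is a part of it. *)
Lemma dvg_series_regularly_varying_gt0 a rho :
  (forall n, 0 <= a n) -> regularly_varying (rho - 1) a -> 0 < rho ->
  ~ cvgn (series a).
Proof.
move=> a_ge0 arv rho0 Scvg; have Smono := nondecreasing_series_ge0 a_ge0.
have pow_gt1 : 1 < 2 `^ rho :> R.
  by rewrite /powR pnatr_eq0/= expR_gt1 mulr_gt0// ln_gt0 ?ltr1n.
(* Any number strictly between 1 and the limit 2 ^ rho of the block ratios. *)
pose lam : R := (1 + 2 `^ rho) / 2.
have [N _ block_ge] : \forall n \near \oo,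
    0 < a n /\ lam * a n <= \sum_(j < 2) a (2 * n + j)%N.
  have a_gt0 := arv.1; near=> n.
  have an0 : 0 < a n by near: n.
  split=> //; rewrite -ler_pdivlMr//.
  near: n; apply: (cvgr_ge (2 `^ rho)); first exact: (block_ratio arv).
  by rewrite /lam; lra.
have Sle := nondecreasing_cvgn_le Smono Scvg.
have lam0 : 0 < lam by rewrite /lam; lra.
set l := limn (series a) in Sle *.
have tail : l <= (l - series a (2 * N)%N) / lam + series a N.
  apply: limr_le => //; near=> k.
  have Nk : (N <= k)%N by near: k; exact: nbhs_infty_ge.
  rewrite -lerBlDr ler_pdivlMr// mulrC.
  apply: (@le_trans _ _ (series a (2 * k)%N - series a (2 * N)%N)); last first.
    by rewrite lerB.
  rewrite !series_block !sub_series_geq// mulr_sumr.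
  rewrite [leLHS]big_nat [leRHS]big_nat ler_sum// => n /andP[Nn _].
  by have [] := block_ge _ Nn.
have step : series a N < series a N.+1.
  by rewrite seriesSr ltrDl; have [] := block_ge N (leqnn _).
have := Sle N.+1; have : series a N <= series a (2 * N)%N.
  by apply: Smono; rewrite leq_pmull.
move: tail; rewrite -lerBlDr ler_pdivlMr// => tail h1 h2.
have : 0 < (l - series a N) * (lam - 1) by rewrite mulr_gt0 ?subr_gt0// /lam; lra.
by lra.
Unshelve. all: by end_near. Qed.

Lemma series_mul_ratio a rho (q : nat) :
  (forall n, 0 <= a n) -> regularly_varying (rho - 1) a ->
  ~ cvgn (series a) -> (0 < q)%N ->
  (series a (q * k)%N / series a k) @[k --> \oo] --> q%:R `^ rho.
Proof.
move=> a_ge0 arv Sdvg q0; under eq_fun do rewrite series_block.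
apply: stolz_series; [exact: arv.1| |exact: block_ratio].
exact: nondecreasing_dvgn_lt (nondecreasing_series_ge0 a_ge0) Sdvg.
Qed.

(** A convergent series of eventually positive terms is slowly varying, and
    convergence forces [rho <= 0]; divergence forces [rho >= 0], and then the
    partial sums have index [rho]. The boundary case [rho = 0] may fall on either
    side, with the same conclusion. The shift by one matches the sum over
    [n <= k] in [degree_pmfE]. *)
Lemma regularly_varying_series a rho :
  (forall n, 0 <= a n) -> regularly_varying (rho - 1) a ->
  regularly_varying (Num.max rho 0) (fun k => series a k.+1).
Proof.
move=> a_ge0 arv; have Smono := nondecreasing_series_ge0 a_ge0.
have S0 := series_gt0 a_ge0 arv.1.
have S1_gt0 : \forall k \near \oo, 0 < series a k.+1.
  by apply: filterS S0 => k /lt_le_trans; apply; apply: Smono.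
have [Scvg|Sdvg] := pselect (cvgn (series a)).
  have rho_le0 : rho <= 0.
    rewrite leNgt; apply/negP => rho0.
    exact: dvg_series_regularly_varying_gt0 a_ge0 arv rho0 Scvg.
  rewrite (max_idPr rho_le0).
  apply: (@cvg_regularly_varying0 _ _ (limn (series a))).
    have [N _ SN] := S0.
    exact: lt_le_trans (SN N (leqnn _)) (nondecreasing_cvgn_le Smono Scvg N).
  by rewrite -(cvg_shiftS (series a)) in Scvg.
have rho_ge0 : 0 <= rho.
  rewrite leNgt; apply/negP => rho0; apply: Sdvg.
  exact: cvg_series_regularly_varying_lt0 a_ge0 arv rho0.
rewrite (max_idPl rho_ge0); split=> // c c0.
have Sq q := @series_mul_ratio a rho q a_ge0 arv Sdvg.
have lim_num : (series a (Num.truncn (c * k%:R)).+1 / series a k) @[k --> \oo]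
    --> c `^ rho.
  apply: (monotone_regularly_varying Smono S0 Sq c0).
  by apply: cvg_ratioS; exact: cvg_truncn_ratio.
have lim_den : (series a k.+1 / series a k) @[k --> \oo] --> (1 : R) `^ rho.
  apply: (monotone_regularly_varying Smono S0 Sq ltr01).
  by under eq_fun do rewrite -natr1; exact: cvg_shift_ratio.
have : (fun k => series a (Num.truncn (c * k%:R)).+1 / series a k /
    (series a k.+1 / series a k)) @ \oo --> c `^ rho / 1 `^ rho.
  by apply: cvgM => //; apply: cvgV => //; rewrite powR1 oner_neq0.
rewrite powR1 divr1 => lim; apply: cvg_trans lim; apply: near_eq_cvg.
apply: filterS2 S0 S1_gt0 => k k0 k1.
by field; rewrite !lt0r_neq0.
Qed.

End PartialSums.

(** * Asymptotics of the product and factorization of the mass function *)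

Section DegreePmf.
Context {R : realType}.
Variables (delta theta : R) (m : nat).
Hypotheses (hdelta : 0 < delta + m%:R) (htheta : 0 < theta).

(** The probability that a process moving from [l] to [l + 1] at rate
    [l + delta], and killed at rate [theta], gets from [m] to [n]. *)
Definition survival (n : nat) : R :=
  \prod_(m <= l < n) ((l%:R + delta) / (l%:R + delta + theta)).

Lemma shift_gt0 l : (m <= l)%N -> 0 < l%:R + delta.
Proof.
by rewrite -(ler_nat R) => ml; rewrite addrC (lt_le_trans hdelta)// lerD2l.
Qed.

Lemma survival_gt0 n : 0 < survival n.
Proof.
rewrite /survival big_nat; apply: prodr_gt0 => l /andP[ml _].
by rewrite divr_gt0 ?[0 < _ + theta]addr_gt0 ?shift_gt0.
Qed.

Lemma survivalS n : (m <= n)%N ->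
  survival n.+1 = survival n * ((n%:R + delta) / (n%:R + delta + theta)).
Proof. by move=> mn; rewrite /survival big_nat_recr. Qed.

Lemma powR_ge1D_le_expR (u rho : R) : 0 <= rho -> 0 <= 1 + u ->
  (1 + u) `^ rho <= expR (rho * u).
Proof.
move=> rho0 u0; rewrite mulrC expRM.
by apply: ge0_ler_powR; rewrite ?nnegrE ?expR_ge0 ?expR_ge1Dx.
Qed.

(** With [x = n + delta], the claim is
    [(1 + 1 / (x + theta)) ^ theta * (1 - theta / (x + theta)) <= 1], and the two
    factors are at most [exp (theta / (x + theta))] and its inverse. *)
Lemma survival_upper_step n : (m <= n)%N ->
  (n.+1%:R + delta + theta) `^ theta * survival n.+1 <=
  (n%:R + delta + theta) `^ theta * survival n.
Proof.
move=> mn; rewrite survivalS// -natr1.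
have := shift_gt0 mn; set x := n%:R + delta => x0.
have -> : n%:R + 1 + delta = x + 1 by rewrite /x; ring.
have y0 : 0 < x + theta by rewrite addr_gt0.
have -> : x + 1 + theta = (x + theta) * (1 + (x + theta)^-1).
  by field; rewrite lt0r_neq0.
have v0 : 0 <= (x + theta)^-1 by rewrite invr_ge0 ltW.
rewrite powRM ?(ltW y0) ?(addr_ge0 ler01 v0)//.
rewrite -mulrA ler_wpM2l ?powR_ge0// mulrCA ler_piMr ?(ltW (survival_gt0 _))//.
have -> : x / (x + theta) = 1 + - (theta * (x + theta)^-1).
  by field; rewrite lt0r_neq0.
rewrite -[leRHS](expRxMexpNx_1 (theta * (x + theta)^-1)).
apply: ler_pM; [exact: powR_ge0| | |exact: expR_ge1Dx]; last first.
  exact: powR_ge1D_le_expR (ltW htheta) (addr_ge0 ler01 v0).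
have -> : 1 - theta / (x + theta) = x / (x + theta) by field; rewrite lt0r_neq0.
by rewrite divr_ge0 ?ltW.
Qed.

(** With [x = n + delta], the claim is
    [(1 - 1 / x) ^ theta * (1 + theta / x) <= 1], and the two factors are at most
    [exp (- theta / x)] and its inverse. *)
Lemma survival_lower_step n : (m < n)%N ->
  (n%:R + delta - 1) `^ theta * survival n <=
  (n.+1%:R + delta - 1) `^ theta * survival n.+1.
Proof.
move=> mn; rewrite (survivalS (ltnW mn)) -natr1.
have x1 : 0 < n%:R + delta - 1.
  by case: n mn => // n mn; rewrite -natr1 addrAC addrK shift_gt0.
have := shift_gt0 (ltnW mn); set x := n%:R + delta in x1 * => x0.
have -> : n%:R + 1 + delta - 1 = x by rewrite /x; ring.
have y0 : 0 < x + theta by rewrite addr_gt0.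
rewrite [X in _ <= _ * X]mulrC mulrA ler_wpM2r ?(ltW (survival_gt0 _))//.
have xE : x - 1 = x * (1 + - x^-1) by field; rewrite lt0r_neq0.
have v0 : 0 <= 1 + - x^-1 by rewrite -(pmulr_rge0 _ x0) -xE ltW.
rewrite xE powRM ?(ltW x0)// ler_wpM2l ?powR_ge0//.
have -> : x / (x + theta) = (1 + theta * x^-1)^-1 by field; rewrite !lt0r_neq0.
have w0 : 0 < 1 + theta * x^-1 by rewrite addr_gt0// divr_gt0.
rewrite -[leRHS]mul1r ler_pdivlMr// -[leRHS](expRxMexpNx_1 (theta * x^-1)) [leLHS]mulrC.
rewrite -mulrN; apply: ler_pM; rewrite ?powR_ge0 ?(ltW w0) ?expR_ge1Dx//.
exact: powR_ge1D_le_expR (ltW htheta) v0.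
Qed.

(** [(k + delta + theta) ^ theta * survival k] is nonincreasing and dominates
    [(k + delta - 1) ^ theta * survival k], which is nondecreasing and positive
    for [k > m]. *)
Lemma survival_asymptotic : exists2 C : R, 0 < C &
  ((k%:R + delta + theta) `^ theta * survival k) @[k --> \oo] --> C.
Proof.
pose D k := (k%:R + delta + theta) `^ theta * survival k.
pose I k := (k%:R + delta - 1) `^ theta * survival k.
(* One step beyond m, so that the base M + delta - 1 is positive. *)
pose M := m.+1.
have Ddec : {homo (fun k => D (k + M)%N) : i j / (i <= j)%N >-> j <= i}.
  apply/nonincreasing_seqP => k; rewrite addSn; apply: survival_upper_step.
  by rewrite (leq_trans _ (leq_addl _ _)).
have Iinc : {homo (fun k => I (k + M)%N) : i j / (i <= j)%N >-> i <= j}.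
  apply/nondecreasing_seqP => k; rewrite addSn; apply: survival_lower_step.
  by rewrite leq_addl.
have IM0 : 0 < I M.
  rewrite mulr_gt0 ?survival_gt0// powR_gt0//.
  by rewrite /M -natr1 addrAC addrK shift_gt0.
have Dge k : I M <= D (k + M)%N.
  rewrite (le_trans (Iinc 0%N k (leq0n _)))//.
  apply: ler_wpM2r; first exact/ltW/survival_gt0.
  have pos : 0 < (k + M)%:R + delta - 1.
    by rewrite /M addnS -natr1 addrAC addrK shift_gt0// leq_addl.
  have := htheta; move: pos; move: (k + M)%:R => t pos theta0.
  by apply: ge0_ler_powR; rewrite ?nnegrE; lra.
have Dcvg : cvgn (fun k => D (k + M)%N).
  by apply: nonincreasing_is_cvgn => //; exists (I M) => _ [k _ <-].
exists (limn (fun k => D (k + M)%N)).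
  by rewrite (lt_le_trans IM0)//; apply: limr_ge => //; exact: nearW.
by rewrite -(cvg_shiftn M).
Qed.

Lemma survival_regularly_varying : regularly_varying (- theta) survival.
Proof.
have [C C0 lim] := survival_asymptotic.
have := regularly_varyingM (cvg_regularly_varying0 C0 lim)
  (powR_shift_regularly_varying (- theta) (delta + theta)).
rewrite add0r; apply: eq_regularly_varying; near=> k.
have mk : (m <= k)%N by near: k; exact: nbhs_infty_ge.
have k0 : 0 < (k%:R + delta + theta) `^ theta.
  by rewrite powR_gt0// addr_gt0// shift_gt0.
by rewrite addrA powRN mulrAC mulfV ?mul1r// lt0r_neq0.
Unshelve. all: by end_near. Qed.

(** The inner product of [degree_pmf] at [i] has the factors of [survival k] of
    index at least [k - i], hence equals [survival k / survival (k - i)] when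
    [m <= k - i]; the other summands vanish with [r]. *)
Lemma degree_pmfE (r : nat -> R) (k : nat) :
  r 0%N = 0 -> (forall n, (n < m)%N -> r n = 0) ->
  degree_pmf r delta theta k = theta / (k%:R + delta + theta) *
    (survival k * series (fun n => r n / survival n) k.+1).
Proof.
move=> r0 rm; rewrite /degree_pmf; congr (_ * _).
rewrite seriesEnat/= big_nat_recl// r0 mul0r add0r big_nat_rev/= mulr_sumr.
apply: eq_big_nat => i /andP[_ ik].
rewrite add0n subKn//.
have [im|mi] := ltnP i.+1 m; first by rewrite rm// !mul0r mulr0.
rewrite mulrCA; congr (_ * _).
rewrite [survival k](big_cat_nat mi ik)/= -/(survival i.+1).
rewrite mulrAC mulfV ?lt0r_neq0 ?survival_gt0// mul1r.
rewrite big_add1 -{2}[i.+1]add0n big_addn [RHS]big_nat_rev/=.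
apply: eq_big_nat => j /andP[_ jk]; rewrite add0n.
have jk' : (j.+1 <= k)%N by rewrite (leq_trans jk)// leq_subr.
have -> : (k - i.+1 - j.+1 + i.+1 = k - j.+1)%N.
  by rewrite subnAC subnK// ltn_subRL addSnnS addnC -ltn_subRL.
by rewrite natrB.
Qed.

End DegreePmf.

(** * Regular variation of the mass function *)

Section DegreePmfRegularVariation.
Context {R : realType}.
Variables (delta theta : R) (m : nat) (r : nat -> R).
Hypotheses (hdelta : 0 < delta + m%:R) (htheta : 0 < theta).
Hypotheses (r_ge0 : forall n, 0 <= r n) (r0 : r 0%N = 0).
Hypothesis r_lt : forall n, (n < m)%N -> r n = 0.

Let weight n := r n / survival delta theta m n.

Let weight_ge0 n : 0 <= weight n.
Proof. by rewrite divr_ge0// ltW// survival_gt0. Qed.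

Lemma degree_pmf_regularly_varying_of_series sigma :
  regularly_varying sigma (fun k => series weight k.+1) ->
  regularly_varying (- (1 + theta) + sigma) (degree_pmf r delta theta).
Proof.
move=> Srv.
have lim_theta : (fun _ : nat => theta) @ \oo --> theta by exact: cvg_cst.
have := regularly_varyingM
  (regularly_varyingM (cvg_regularly_varying0 htheta lim_theta)
     (powR_shift_regularly_varying (-1) (delta + theta)))
  (regularly_varyingM (survival_regularly_varying hdelta htheta) Srv).
rewrite add0r addrA -opprD; apply: eq_regularly_varying; near=> k.
rewrite (degree_pmfE hdelta htheta _ r0 r_lt) powR_inv1 ?addrA// -addrA.
have mk : (m <= k)%N by near: k; exact: nbhs_infty_ge.
by rewrite addrA ltW// addr_gt0// (shift_gt0 hdelta).
Unshelve. all: by end_near. Qed.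

Lemma degree_pmf_regularly_varying tau :
  regularly_varying (- tau) r ->
  regularly_varying (- Num.min tau (1 + theta)) (degree_pmf r delta theta).
Proof.
move=> rrv.
have wrv : regularly_varying (theta - tau + 1 - 1) weight.
  rewrite addrK addrC -[X in - tau + X]opprK.
  exact: regularly_varyingM rrv
    (regularly_varyingV (survival_regularly_varying hdelta htheta)).
have := degree_pmf_regularly_varying_of_series
  (regularly_varying_series weight_ge0 wrv).
suff -> : - Num.min tau (1 + theta) =
  - (1 + theta) + Num.max (theta - tau + 1) 0 by [].
by case: (leP tau (1 + theta)); case: (leP (theta - tau + 1) 0); lra.
Qed.

(** The weights [r n / survival n] are of order [n ^ theta * r n], hence negligible
    against [n ^ -2], so their series converges. *)
Lemma degree_pmf_regularly_varying_of_fast_decay :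
  (exists n, 0 < r n) -> faster_than_power_law r ->
  regularly_varying (- (1 + theta)) (degree_pmf r delta theta).
Proof.
move=> [n rn] rfast; rewrite -[X in regularly_varying X]addr0.
apply: degree_pmf_regularly_varying_of_series.
have Wmono := nondecreasing_series_ge0 weight_ge0.
have [C C0 lim_survival] := survival_asymptotic hdelta htheta.
(* Adding n ^ -2 turns the weights, about which only an upper bound is known,
   into a regularly varying sequence of index -2, whose series converges. *)
pose b k := weight k + k%:R `^ (-2).
have b_ge0 k : 0 <= b k by rewrite addr_ge0 ?powR_ge0.
have brv : regularly_varying (- 1 - 1) b.
  have lim : (fun k => (k%:R `^ (2 + theta) * r k) *
      ((k%:R + (delta + theta)) / k%:R) `^ theta /
      ((k%:R + delta + theta) `^ theta * survival delta theta m k) + 1)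
      @ \oo --> 0 * 1 `^ theta / C + 1.
    apply: cvgD; last exact: cvg_cst.
    apply: cvgM; last by apply: cvgV => //; rewrite lt0r_neq0.
    apply: cvgM; first by apply: rfast; rewrite addr_gt0.
    by apply: cvg_powR => //; exact: cvg_shift_ratio.
  rewrite mul0r mul0r add0r in lim.
  have := regularly_varyingM (powR_regularly_varying (- 2))
    (cvg_regularly_varying0 ltr01 lim).
  rewrite addr0 -opprD; apply: eq_regularly_varying; near=> k.
  have k0 : 0 < k%:R :> R by rewrite ltr0n; near: k; exact: nbhs_infty_gt.
  have mk : (m <= k)%N by near: k; exact: nbhs_infty_ge.
  have kt0 : 0 < k%:R + delta + theta.
    by rewrite addr_gt0// (shift_gt0 hdelta).
  have A0 := survival_gt0 hdelta htheta k.
  rewrite addrA powR_div ?(ltW kt0) ?(ltW k0)// powRN /b /weight.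
  rewrite (@powRD _ _ 2 theta) ?(gt_eqF k0) ?implybT//.
  have := powR_gt0 2 k0; have := powR_gt0 theta k0; have := powR_gt0 theta kt0.
  rewrite powRN; move: (_ `^ theta) (_ `^ theta) (_ `^ 2) => x y z x0 y0 z0.
  by field; rewrite !lt0r_neq0.
have Bcvg : cvgn (series b).
  by apply: (cvg_series_regularly_varying_lt0 b_ge0 brv); rewrite oppr_lt0.
have Wcvg : cvgn (series weight).
  apply: nondecreasing_is_cvgn => //; exists (limn (series b)) => _ [k _ <-].
  have Bmono := nondecreasing_series_ge0 b_ge0.
  rewrite (le_trans _ (nondecreasing_cvgn_le Bmono Bcvg k))//.
  by apply: ler_sum => i _; rewrite lerDl powR_ge0.
apply: (@cvg_regularly_varying0 _ _ (limn (series weight))); last first.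
  by rewrite -(cvg_shiftS (series weight)) in Wcvg.
apply: lt_le_trans (nondecreasing_cvgn_le Wmono Wcvg n.+1).
by rewrite seriesSr ltr_wpDl ?sumr_ge0// divr_gt0// survival_gt0.
Unshelve. all: by end_near. Qed.

End DegreePmfRegularVariation.

(** * Mass function and mean of an integer-valued random variable *)

Section NatRandomVariable.
Context d (T : measurableType d) (R : realType) (P : probability T R).
Variable W : {RV P >-> nat}.

Let measurable_level k : measurable (W @^-1` [set k]).
Proof. by rewrite -[_ @^-1` _]setTI; exact: (measurable_funP W). Qed.

Lemma natpmf_ge0 k : 0 <= natpmf W k.
Proof. by rewrite fine_ge0. Qed.

Lemma EFin_natpmf k : (natpmf W k)%:E = P (W @^-1` [set k]).
Proof. by rewrite fineK// fin_num_measure. Qed.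

Lemma ae_natsupport : \forall w \ae P, natsupport W (W w).
Proof.
apply: (@negligibleS _ _ _ _ (\bigcup_k [set w | W w = k /\ ~ natsupport W k])).
  by move=> w /= nSw; exists (W w).
apply: negligible_bigcup => k.
have [Sk|nSk] := pselect (natsupport W k).
  by apply: negligibleS (negligible_set0 _) => w [_ /(_ Sk)].
apply: (@negligibleS _ _ _ _ (W @^-1` [set k])) => [w []//|].
apply/negligibleP; first exact: measurable_level.
apply: (etrans (esym (EFin_natpmf k))); congr (_%:E).
by apply/eqP; rewrite eq_le natpmf_ge0 andbT leNgt; exact/negP.
Qed.

Lemma natsupport_neq0 : natsupport W !=set0.
Proof.
apply: contrapT => noS.
have : P.-negligible setT.
  by apply: negligibleS ae_natsupport => w _ Sw; apply: noS; exists (W w).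
move=> /(negligibleP _ measurableT) PT0.
by have := @probability_setT _ _ _ P; rewrite [LHS]PT0 => /eqP; rewrite lt_eqF.
Qed.

Lemma natpmf_lt_setmin k : (k < setmin (natsupport W))%N -> natpmf W k = 0.
Proof.
have [_ minS] := setminP natsupport_neq0 => km.
apply/eqP; rewrite eq_le natpmf_ge0 andbT leNgt; apply/negP => k0.
by have := minS k k0; rewrite leEnat leqNgt km.
Qed.

(** The first alternative is the value that [natmean] takes when the expectation
    is infinite. *)
Lemma natmean_ge_setmin :
  natmean W = 0 \/ (setmin (natsupport W))%:R <= natmean W.
Proof.
rewrite /natmean; set m := setmin _.
have mW : measurable_fun setT (fun w => (W w)%:R : R).
  exact: measurableT_comp.
have : ('E_P[cst m%:R] <= 'E_P[fun w => (W w)%:R])%E.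
  apply: expectation_le => //.
  have [_ minS] := setminP natsupport_neq0.
  by apply: filterS ae_natsupport => w /minS; rewrite ler_nat leEnat.
rewrite expectation_cst; case: ('E_P[_])%E => [x| |]//=; last by left.
by rewrite lee_fin; right.
Qed.

End NatRandomVariable.

(** * The power law *)

Lemma regularly_varying_slowly_varying_factor (R : realType) (tau : R)
    (p : nat -> R) : regularly_varying (- tau) p ->
  exists Lhat : nat -> R, slowly_varying Lhat /\
    forall k : nat, (1 <= k)%N -> p k = k%:R `^ (- tau) * Lhat k.
Proof.
move=> prv; exists (fun k => k%:R `^ tau * p k); split.
  apply/regularly_varying0; rewrite -(subrr tau).
  exact: regularly_varyingM (powR_regularly_varying tau) prv.
move=> k k1; rewrite mulrA powRN mulVf ?mul1r//.
by rewrite lt0r_neq0// powR_gt0// ltr0n.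
Qed.

Theorem proposition1p4 (R : realType) (d : measure_display)
    (T : measurableType d) (P : probability T R) (W : {RV P >-> nat})
    (W_gt0 : forall w : T, (0 < W w)%N)
    (delta : R) (hdelta : 0 < delta + (setmin (natsupport W))%:R) :
  let r := natpmf W in
  let mu := natmean W in
  let theta := 2 + delta / mu in
  let p := degree_pmf r delta theta in
  let tauP := 3 + delta / mu in
  (forall (tauW : R) (L : nat -> R),
     2 < tauW -> slowly_varying L ->
     (forall k : nat, (1 <= k)%N -> r k = k%:R `^ (- tauW) * L k) ->
     exists Lhat : nat -> R, slowly_varying Lhat /\
       forall k : nat, (1 <= k)%N ->
         p k = k%:R `^ (- Num.min tauW tauP) * Lhat k) /\
  (faster_than_power_law r ->
     exists Lhat : nat -> R, slowly_varying Lhat /\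
       forall k : nat, (1 <= k)%N ->
         p k = k%:R `^ (- tauP) * Lhat k).
Proof.
move=> r mu theta p tauP; set m := setmin _ in hdelta.
have r0 : r 0%N = 0.
  rewrite /r /natpmf; have -> : W @^-1` [set 0%N] = set0.
    by apply/seteqP; split=> // w /= Ww0; have := W_gt0 w; rewrite Ww0.
  by rewrite measure0.
have m0 : 0 < m%:R :> R.
  have [Sm _] := setminP (natsupport_neq0 W); rewrite ltr0n lt0n.
  apply/eqP => m_eq0; move: Sm; rewrite -/m m_eq0.
  by rewrite /natsupport/= -/r r0 ltxx.
(* The mean is at least m > - delta, so delta / mu > -1; if the mean has the
   value 0, then so does delta / mu. *)
have htheta : 0 < theta.
  have [mu0|m_le_mu] := natmean_ge_setmin W.
    by rewrite /theta /mu mu0 invr0 mulr0 addr0.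
  have mu0 : 0 < mu by exact: lt_le_trans m_le_mu.
  have -> : theta = (mu + (mu + delta)) / mu.
    by rewrite /theta; field; rewrite lt0r_neq0.
  rewrite divr_gt0// addr_gt0//.
  by rewrite (lt_le_trans hdelta)// addrC lerD2r.
have r_ge0 n : 0 <= r n by exact: natpmf_ge0.
have r_lt n : (n < m)%N -> r n = 0 by exact: natpmf_lt_setmin.
have tauPE : tauP = 1 + theta by rewrite /tauP /theta; ring.
split=> [tauW L _ Lsv rE|rfast];
  apply: regularly_varying_slowly_varying_factor; rewrite tauPE.
  apply: (degree_pmf_regularly_varying hdelta htheta r_ge0 r0 r_lt).
  have := regularly_varyingM (powR_regularly_varying (- tauW))
    ((regularly_varying0 L).2 Lsv).
  rewrite addr0; apply: eq_regularly_varying.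
  by exists 1%N => // k /= k1; rewrite rE.
apply: (degree_pmf_regularly_varying_of_fast_decay hdelta htheta) => //.
by have [k rk] := natsupport_neq0 W; exists k.
Qed.
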